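(* Let $F\in\mathbb{R}[x,y]$, let $\mathcal{C}=\{F=0\}\subset\mathbb{R}^2$, and let $P=(a,b)$ be a regular point of $\mathcal{C}$, i.e. $F(P)=0$ and $\nabla F(P)=(F_x,F_y)\neq(0,0)$ at $P$. Then the curvature of $\mathcal{C}$ at $P$ computed by the quadratic-contact algorithm described in the context agrees with the curvature formula for regular implicit plane curves. That is, for every quadratic parametric curve $$\mathbf{r}(t)=\Bigl(a+a_1t+\tfrac12a_2t^2,\ b+b_1t+\tfrac12b_2t^2\Bigr),\qquad (a_1,b_1)\neq(0,0),$$ such that the coefficients $C_1$ of $t$ and $C_2$ of $t^2$ in $F(\mathbf{r}(t))$ both vanish, the curvature $k=\dfrac{|a_1b_2-a_2b_1|}{(a_1^2+b_1^2)^{3/2}}$ of $\mathbf{r}$ at $t=0$ satisfies $$k=\frac{|\mathrm{Tan}(F)\,H(F)\,\mathrm{Tan}(F)^T|}{|\nabla F|^3}=\frac{\left|\begin{pmatrix} -F_y & F_x \end{pmatrix}\begin{pmatrix} F_{xx} & F_{xy} \\ F_{yx} & F_{yy} \end{pmatrix}\begin{pmatrix} -F_y \\ F_x \end{pmatrix}\right|}{(F_x^2+F_y^2)^{3/2}},$$ where all derivatives of $F$ are evaluated at $P$.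
   Context: Here $\mathrm{Tan}(F)=(-F_y,F_x)$ and $H(F)$ is the Hessian matrix of $F$. Algorithm (plane curves). Let $P=(a,b)$ be a point of $\mathcal{C}=\{F=0\}$ of multiplicity $r$ ($r$ is the least order for which some partial derivative of $F$ is nonzero at $P$; $r=1$ exactly when $P$ is regular). Take a quadratic parametric curve $\mathbf{r}(t)=(a+a_1t+\frac12a_2t^2,\,b+b_1t+\frac12b_2t^2)$ with $(a_1,b_1)\ne(0,0)$ and expand $F(\mathbf{r}(t))=C_1t+C_2t^2+\cdots$. The tangents $(a_1,b_1)$ to $\mathcal{C}$ at $P$ are determined by $C_r=0$. With such $(a_1,b_1)$ substituted, the next coefficient that is not identically zero is set to zero, which constrains $(a_2,b_2)$. The curvature of $\mathcal{C}$ at $P$ along $(a_1,b_1)$ is defined to be the curvature $|a_1b_2-a_2b_1|/(a_1^2+b_1^2)^{3/2}$ of $\mathbf{r}$ at $t=0$. For a regular point ($r=1$) the conditions imposed are exactly $C_1=0$ and $C_2=0$. *)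

(* Defs.v *)
(* The real numbers are an arbitrary [R : realType]. *)
From mathcomp Require Import all_boot all_order all_algebra.
From mathcomp Require Import mpoly.
From mathcomp Require Import reals.
From mathcomp Require Import exp.
Set Implicit Arguments.
Unset Strict Implicit.
Unset Printing Implicit Defensive.
Import Order.TTheory GRing.Theory Num.Theory.
Local Open Scope ring_scope.

Definition pair2 (T : Type) (u v : T) : 'I_2 -> T := tnth [tuple u; v].

(* In {mpoly R[2]} the variable of index 0 is x and the one of index 1 is y. *)
Definition Dx (R : realType) (F : {mpoly R[2]}) : {mpoly R[2]} :=
  mderiv (ord0 : 'I_2) F.
Definition Dy (R : realType) (F : {mpoly R[2]}) : {mpoly R[2]} :=
  mderiv (ord_max : 'I_2) F.

Definition gradient (R : realType) (F : {mpoly R[2]}) (P : 'I_2 -> R) :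
  'rV[R]_2 := \row_(j < 2) (mderiv j F).@[P].

Definition Tan (R : realType) (F : {mpoly R[2]}) (P : 'I_2 -> R) : 'rV[R]_2 :=
  \row_(j < 2) pair2 (- (Dy F).@[P]) (Dx F).@[P] j.

Definition hessian (R : realType) (F : {mpoly R[2]}) (P : 'I_2 -> R) :
  'M[R]_2 := \matrix_(i < 2, j < 2) (mderiv j (mderiv i F)).@[P].

(* The norm that the library puts on row vectors is the sup norm, hence this
   definition. *)
Definition eucl_norm (R : realType) (n : nat) (v : 'rV[R]_n) : R :=
  Num.sqrt (\sum_(i < n) v ord0 i ^+ 2).

Definition regular_point (R : realType) (F : {mpoly R[2]}) (P : 'I_2 -> R) :
  Prop := F.@[P] = 0 /\ gradient F P <> 0.

(* The curve t |-> (a + a1 t + a2 t^2 / 2, b + b1 t + b2 t^2 / 2), given by its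
   two coordinate polynomials in t. *)
Definition quad_curve (R : realType) (a b a1 b1 a2 b2 : R) :
  'I_2 -> {poly R} :=
  pair2 (a%:P + a1 *: 'X + (a2 / 2) *: 'X^2)
        (b%:P + b1 *: 'X + (b2 / 2) *: 'X^2).

(* The polynomial F(r(t)) in t: [meval] takes place in {poly R}, after
   embedding the coefficients of F as constants. *)
Definition subst_curve (R : realType) (F : {mpoly R[2]})
  (r : 'I_2 -> {poly R}) : {poly R} := (map_mpoly (@polyC R) F).@[r].

Definition contact_coef (R : realType) (F : {mpoly R[2]})
  (r : 'I_2 -> {poly R}) (k : nat) : R := (subst_curve F r)`_k.

(* |x' y'' - x'' y'| / (x'^2 + y'^2)^(3/2) at parameter t. *)
Definition curvature (R : realType) (r : 'I_2 -> {poly R}) (t : R) : R :=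
  let x := r ord0 in let y := r ord_max in
  `| x^`().[t] * y^`(2).[t] - x^`(2).[t] * y^`().[t] |
    / (x^`().[t] ^+ 2 + y^`().[t] ^+ 2) `^ (3 / 2).

(* Main.v *)
(* Expanding F(r(t)) by the chain rule, C_1 = 0 says that the velocity (a1, b1)
   is orthogonal to the gradient, i.e. (a1, b1) = c Tan(F) with c <> 0, and
   2 C_2 = 0 says that Q(a1, b1) + F_x a2 + F_y b2 = 0, where Q is the Hessian
   quadratic form. Hence a1 b2 - a2 b1 = - c (F_x a2 + F_y b2) =
   c^3 Q(Tan(F)), while (a1^2 + b1^2)^(3/2) = |c|^3 |grad F|^3. *)
Require Import Defs.
From mathcomp Require Import all_boot all_order all_algebra.
From mathcomp Require Import mpoly.
From mathcomp Require Import reals.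
From mathcomp Require Import exp.
From mathcomp Require Import ring.
Set Implicit Arguments.
Unset Strict Implicit.
Unset Printing Implicit Defensive.
Import Order.TTheory GRing.Theory Num.Theory.
Local Open Scope ring_scope.

(** * Evaluation of multivariate polynomials and the formal chain rule *)

Lemma eq_mpoly_rmorphism (R S : comNzRingType) (n : nat)
  (phi psi : {rmorphism {mpoly R[n]} -> S}) :
  (forall c, phi c%:MP = psi c%:MP) -> (forall i, phi 'X_i = psi 'X_i) ->
  phi =1 psi.
Proof.
move=> eqC eqX; elim/mpolyind => [|c m F _ _ IH]; first by rewrite !rmorph0.
rewrite !rmorphD IH -mul_mpolyC !rmorphM eqC mpolyXE_id !rmorph_prod.
by congr (_ * _ + _); apply: eq_bigr => i _; rewrite !rmorphXn eqX.
Qed.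

(** Both sides are ring morphisms in [F], so it suffices to compare them on constants and on
    variables. *)
Lemma horner_meval (R : comNzRingType) (n : nat) (F : {mpoly R[n]})
  (r : 'I_n -> {poly R}) (x : R) :
  (map_mpoly (@polyC R) F).@[r].[x] = F.@[fun i => (r i).[x]].
Proof.
pose phi : {rmorphism {mpoly R[n]} -> R} :=
  horner_eval x \o (meval r \o map_mpoly (@polyC R)).
apply: (eq_mpoly_rmorphism (phi := phi)) => [c|i].
  by rewrite /phi /= /horner_eval map_mpolyC !mevalC hornerC.
by rewrite /phi /= /horner_eval map_mpolyX !mevalXU.
Qed.

Section ChainRule.

Variables (R : comNzRingType) (n : nat).
Variable phi : {rmorphism {mpoly R[n]} -> {poly R}}.
Hypothesis phiC : forall c, phi c%:MP = c%:P.

(** The polynomials that obey the chain rule contain the constants and the variables and are closed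
    under products and sums, so induction on [F] reaches them all. *)
Let chain_at F := (phi F)^`() = \sum_i phi (mderiv i F) * (phi 'X_i)^`().

Let chain_atC c : chain_at c%:MP.
Proof.
rewrite /chain_at phiC derivC big1 // => i _.
by rewrite mderivC rmorph0 mul0r.
Qed.

Let chain_atM F G : chain_at F -> chain_at G -> chain_at (F * G).
Proof.
rewrite /chain_at => dF dG; rewrite rmorphM derivM dF dG.
rewrite mulr_suml mulr_sumr -big_split; apply: eq_bigr => i _ /=.
by rewrite mderivM rmorphD !rmorphM mulrDl mulrAC mulrA.
Qed.

Let chain_atX i : chain_at 'X_i.
Proof.
rewrite /chain_at (bigD1 i) //= big1 => [|j neq_ji].
  (* The derived monomial has exponent [U_(i) - U_(i)]; writing the first term as [0 + U_(i)] lets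
     the subtraction cancel. *)
  rewrite mderivX mnm1E eqxx -[X in (X - U_(i))%MM]add0m addmK mpolyX0.
  by rewrite scale1r rmorph1 mul1r addr0.
by rewrite mderivX mnm1E eq_sym (negPf neq_ji) scale0r rmorph0 mul0r.
Qed.

Lemma deriv_mpoly_rmorphism F :
  (phi F)^`() = \sum_i phi (mderiv i F) * (phi 'X_i)^`().
Proof.
rewrite -/(chain_at F).
elim/mpolyind: F => [|c m F _ _ IH]; first exact: (chain_atC 0).
have chain_cm : chain_at (c *: 'X_[m]).
  (* A term is a constant times a product of powers of variables, so closure under products settles
     it. *)
  rewrite -mul_mpolyC mpolyXE_id; apply: chain_atM => //.
  apply: (big_ind chain_at) => [||i _].
  - exact: (chain_atC 1).
  - exact: chain_atM.
  elim: (m i) => [|k IHk]; first exact: (chain_atC 1).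
  by rewrite exprS; apply: chain_atM.
rewrite /chain_at rmorphD derivD chain_cm IH -big_split.
by apply: eq_bigr => i _ /=; rewrite mderivD rmorphD mulrDl.
Qed.

End ChainRule.

Lemma deriv_meval (R : comNzRingType) (n : nat) (F : {mpoly R[n]})
  (r : 'I_n -> {poly R}) :
  ((map_mpoly (@polyC R) F).@[r])^`() =
  \sum_i (map_mpoly (@polyC R) (mderiv i F)).@[r] * (r i)^`().
Proof.
pose phi : {rmorphism {mpoly R[n]} -> {poly R}} :=
  meval r \o map_mpoly (@polyC R).
have phiC c : phi c%:MP = c%:P by rewrite /phi /= map_mpolyC mevalC.
rewrite [LHS](deriv_mpoly_rmorphism phiC); apply: eq_bigr => i _ /=.
by rewrite map_mpolyX mevalXU.
Qed.

Lemma pair2_0 (T : Type) (u v : T) : pair2 u v ord0 = u.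
Proof. by []. Qed.

Lemma pair2_max (T : Type) (u v : T) : pair2 u v ord_max = v.
Proof. by []. Qed.

(** Case analysis that produces [ord0] and [ord_max] themselves, the indices used by [pair2], [Dx]
    and [Dy]. *)
Lemma ord2_ind (Q : 'I_2 -> Prop) : Q ord0 -> Q ord_max -> forall i, Q i.
Proof.
by move=> Q0 Q1 [[|[|//]] lt_i2]; [move: Q0 | move: Q1];
  congr Q; apply: val_inj.
Qed.

Lemma big_ord2 (V : nmodType) (f : 'I_2 -> V) :
  \sum_i f i = f ord0 + f ord_max.
Proof. by rewrite big_ord_recr big_ord1; congr (f _ + f _); apply: val_inj. Qed.

(** Links the real power in [curvature] to the cube of a square root, as in the cubed Euclidean
    norm. *)
Lemma powR_3half (R : realType) (x : R) :
  0 <= x -> x `^ (3 / 2) = Num.sqrt x ^+ 3.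
Proof.
by move=> x_ge0; rewrite mulrC powRrM powR12_sqrt // powR_mulrn ?sqrtr_ge0.
Qed.

(** * Contact coefficients of a quadratic curve *)

Section QuadraticContact.

Variables (R : realType) (F : {mpoly R[2]}) (a b a1 b1 a2 b2 : R).

Local Notation r := (quad_curve a b a1 b1 a2 b2).
Local Notation P := (pair2 a b).

Lemma quad_curve_horner0 (i : 'I_2) : (r i).[0] = P i.
Proof.
by elim/ord2_ind: i; rewrite /quad_curve ?pair2_0 ?pair2_max horner_coef0;
  rewrite !coefE /= !mulr0 !addr0.
Qed.

Lemma deriv_quad_curve_horner0 (i : 'I_2) : (r i)^`().[0] = pair2 a1 b1 i.
Proof.
by elim/ord2_ind: i; rewrite /quad_curve ?pair2_0 ?pair2_max horner_coef0;
  rewrite coef_deriv !coefE /= mulr1 mulr0 add0r addr0.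
Qed.

Lemma deriv2_quad_curve_horner0 (i : 'I_2) :
  (r i)^`()^`().[0] = pair2 a2 b2 i.
Proof.
by elim/ord2_ind: i; rewrite /quad_curve ?pair2_0 ?pair2_max horner_coef0;
  (* Two derivations multiply the coefficient of ['X^2] by 2, which cancels the halves in
     [quad_curve]. *)
  rewrite !coef_deriv !coefE /= mulr1 mulr0 !add0r ?mulr1n -[LHS]mulr_natr divfK
    ?pnatr_eq0.
Qed.

Lemma meval_quad_curve0 (G : {mpoly R[2]}) : (subst_curve G r).[0] = G.@[P].
Proof. by rewrite horner_meval; apply/meval_eq/quad_curve_horner0. Qed.

Lemma deriv_subst_curve (G : {mpoly R[2]}) :
  (subst_curve G r)^`() = subst_curve (Dx G) r * (r ord0)^`()
                        + subst_curve (Dy G) r * (r ord_max)^`().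
Proof. by rewrite [LHS]deriv_meval big_ord2. Qed.

Lemma contact_coef1 :
  contact_coef F r 1 = (Dx F).@[P] * a1 + (Dy F).@[P] * b1.
Proof.
transitivity (subst_curve F r)^`().[0].
  by rewrite horner_coef0 coef_deriv.
have hornerDM (p q u v : {poly R}) :
    (p * u + q * v).[0] = p.[0] * u.[0] + q.[0] * v.[0].
  by rewrite hornerD !hornerM.
rewrite deriv_subst_curve hornerDM.
by congr (_ * _ + _ * _);
  [exact: meval_quad_curve0 | exact: deriv_quad_curve_horner0
  |exact: meval_quad_curve0 | exact: deriv_quad_curve_horner0].
Qed.

(** The second derivative of F(r(t)) at 0 is twice the coefficient of t^2, hence the doubling. *)
Lemma contact_coef2 :
  contact_coef F r 2 *+ 2 =
    (Dx (Dx F)).@[P] * a1 ^+ 2 + (Dy (Dx F)).@[P] * a1 * b1 *+ 2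
    + (Dy (Dy F)).@[P] * b1 ^+ 2 + (Dx F).@[P] * a2 + (Dy F).@[P] * b2.
Proof.
transitivity (subst_curve F r)^`()^`().[0].
  by rewrite horner_coef0 !coef_deriv.
have DyxE : Dx (Dy F) = Dy (Dx F) by exact: mderiv_comm.
(* The chain rule applied twice, over abstract polynomials so that [ring] sees only atoms; one [fxy]
   serves for both mixed derivatives, by [DyxE]. *)
have horner_deriv2 (f fx fy fxx fxy fyy x y : {poly R}) :
    f^`() = fx * x^`() + fy * y^`() -> fx^`() = fxx * x^`() + fxy * y^`() ->
    fy^`() = fxy * x^`() + fyy * y^`() ->
  f^`()^`().[0] =
    fxx.[0] * x^`().[0] ^+ 2 + fxy.[0] * x^`().[0] * y^`().[0] *+ 2
    + fyy.[0] * y^`().[0] ^+ 2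
    + fx.[0] * x^`()^`().[0] + fy.[0] * y^`()^`().[0].
  move=> -> fx' fy'; rewrite derivD !derivM fx' fy' !(hornerD, hornerM); ring.
have dDyF := deriv_subst_curve (Dy F); rewrite DyxE in dDyF.
rewrite (horner_deriv2 _ _ _ _ _ _ _ _ (deriv_subst_curve F)
  (deriv_subst_curve (Dx F)) dDyF).
have /[!pair2_0] x1 := deriv_quad_curve_horner0 ord0.
have /[!pair2_max] y1 := deriv_quad_curve_horner0 ord_max.
have /[!pair2_0] x2 := deriv2_quad_curve_horner0 ord0.
have /[!pair2_max] y2 := deriv2_quad_curve_horner0 ord_max.
by congr (_ * _ ^+ 2 + _ * _ * _ *+ 2 + _ * _ ^+ 2 + _ * _ + _ * _) => //;
  exact: meval_quad_curve0.
Qed.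

Lemma curvature_quad_curve :
  curvature r 0 = `|a1 * b2 - a2 * b1| / (a1 ^+ 2 + b1 ^+ 2) `^ (3 / 2).
Proof.
by rewrite /curvature !derivnS !derivn0 !deriv_quad_curve_horner0
  !deriv2_quad_curve_horner0.
Qed.

End QuadraticContact.

(** * The curvature identity between real numbers *)

Lemma contact_curvature (R : realType) (fx fy fxx fxy fyy a1 b1 a2 b2 : R) :
  (fx, fy) <> (0, 0) -> (a1, b1) <> (0, 0) ->
  fx * a1 + fy * b1 = 0 ->
  fxx * a1 ^+ 2 + fxy * a1 * b1 *+ 2 + fyy * b1 ^+ 2 + fx * a2 + fy * b2 = 0 ->
  `|a1 * b2 - a2 * b1| / (a1 ^+ 2 + b1 ^+ 2) `^ (3 / 2) =
  `|fxx * fy ^+ 2 - fxy * fx * fy *+ 2 + fyy * fx ^+ 2|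
    / (fx ^+ 2 + fy ^+ 2) `^ (3 / 2).
Proof.
move=> f_neq0 v_neq0 C1 C2.
have sqr_neq0 (u v : R) : (u, v) <> (0, 0) -> u ^+ 2 + v ^+ 2 != 0.
  move=> uv_neq0; rewrite paddr_eq0 ?sqr_ge0 // !sqrf_eq0.
  by apply/negP => /andP[/eqP u0 /eqP v0]; apply: uv_neq0; rewrite u0 v0.
set g := fx ^+ 2 + fy ^+ 2.
have g_neq0 : g != 0 by exact: sqr_neq0.
have g_ge0 : 0 <= g by rewrite addr_ge0 ?sqr_ge0.
(* By [C1] the velocity (a1, b1) is [c (- fy, fx)]. *)
pose c := (b1 * fx - a1 * fy) / g.
have a1E : a1 = - (c * fy).
  apply: (mulIf g_neq0); rewrite /c mulNr mulrAC divfK //.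
  (* The velocity times [g], split along the orthogonal frame formed by the gradient and the
     tangent; [C1] kills the gradient part. *)
  transitivity (fx * (fx * a1 + fy * b1) - (b1 * fx - a1 * fy) * fy); last first.
    by rewrite C1 mulr0 sub0r.
  rewrite /g; ring.
have b1E : b1 = c * fx.
  apply: (mulIf g_neq0); rewrite /c mulrAC divfK //.
  transitivity (fy * (fx * a1 + fy * b1) + (b1 * fx - a1 * fy) * fx); last first.
    by rewrite C1 mulr0 add0r.
  rewrite /g; ring.
have c_neq0 : c != 0.
  apply/eqP => c0; apply: v_neq0.
  by rewrite a1E b1E c0 !mul0r oppr0.
have -> : a1 * b2 - a2 * b1 =
    c ^+ 3 * (fxx * fy ^+ 2 - fxy * fx * fy *+ 2 + fyy * fx ^+ 2).
  transitivity (- c * (fx * a2 + fy * b2)); first by rewrite a1E b1E; ring.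
  (* Subtracting the vanishing left side of [C2] leaves minus the Hessian form at the velocity,
     which contributes [c ^+ 2]. *)
  rewrite -[fx * a2 + _](subr0) -C2 a1E b1E; ring.
have -> : a1 ^+ 2 + b1 ^+ 2 = c ^+ 2 * g by rewrite /g a1E b1E; ring.
(* As the square root of [c ^+ 2] is the absolute value of [c], the factor c^3 cancels up to sign,
   and the outer absolute value absorbs the sign. *)
rewrite powRM ?sqr_ge0 // (powR_3half (sqr_ge0 c)) sqrtr_sqr -normrX normrM.
by rewrite -mulf_div divff ?mul1r // normr_eq0 expf_neq0.
Qed.

(** * Translation into matrix form *)

Theorem theorem1 (R : realType) (F : {mpoly R[2]}) (a b : R)
  (hP : regular_point F (pair2 a b)) (a1 b1 a2 b2 : R)
  (hv : (a1, b1) <> (0, 0))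
  (hC1 : contact_coef F (quad_curve a b a1 b1 a2 b2) 1 = 0)
  (hC2 : contact_coef F (quad_curve a b a1 b1 a2 b2) 2 = 0) :
  let P := pair2 a b in
  let k := curvature (quad_curve a b a1 b1 a2 b2) 0 in
  let Fx := (Dx F).@[P] in
  let Fy := (Dy F).@[P] in
  let Fxx := (Dx (Dx F)).@[P] in
  let Fxy := (Dy (Dx F)).@[P] in
  let Fyx := (Dx (Dy F)).@[P] in
  let Fyy := (Dy (Dy F)).@[P] in
  [/\ k = `| a1 * b2 - a2 * b1 | / (a1 ^+ 2 + b1 ^+ 2) `^ (3 / 2),
      k = `| (Tan F P *m hessian F P *m (Tan F P)^T) ord0 ord0 |
            / eucl_norm (gradient F P) ^+ 3
    & k = `| ((\row_(j < 2) pair2 (- Fy) Fx j)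
              *m (\matrix_(i < 2, j < 2)
                    pair2 (pair2 Fxx Fxy) (pair2 Fyx Fyy) i j)
              *m (\col_(i < 2) pair2 (- Fy) Fx i)) ord0 ord0 |
            / (Fx ^+ 2 + Fy ^+ 2) `^ (3 / 2)].
Proof.
move=> P k Fx Fy Fxx Fxy Fyx Fyy.
have FyxE : Fyx = Fxy by rewrite /Fyx /Fxy; congr meval; apply: mderiv_comm.
have grad_neq0 : (Fx, Fy) <> (0, 0).
  case=> Fx0 Fy0; case: hP => _; apply; apply/rowP => i.
  by elim/ord2_ind: i; rewrite !mxE.
have kE := curvature_quad_curve a b a1 b1 a2 b2.
have kF := kE; rewrite (contact_curvature grad_neq0 hv (fxx := Fxx)
  (fxy := Fxy) (fyy := Fyy)) in kF; last first.
- by rewrite -contact_coef2 hC2 mul0rn.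
- by rewrite -(contact_coef1 F a b a1 b1 a2 b2).
(* Expands the single entry of row times matrix times column; the data are functions of the index,
   to match [pair2]. *)
have quadE (u v : 'I_2 -> R) (M : 'I_2 -> 'I_2 -> R) :
    ((\row_j u j) *m (\matrix_(i, j) M i j) *m (\col_i v i)) ord0 ord0 =
    u ord0 * M ord0 ord0 * v ord0 + u ord_max * M ord_max ord0 * v ord0
    + u ord0 * M ord0 ord_max * v ord_max
    + u ord_max * M ord_max ord_max * v ord_max.
  by rewrite !mxE big_ord2 !mxE !big_ord2 !mxE !mulrDl addrA.
have matE : ((\row_(j < 2) pair2 (- Fy) Fx j)
              *m (\matrix_(i < 2, j < 2)
                    pair2 (pair2 Fxx Fxy) (pair2 Fyx Fyy) i j)
              *m (\col_(i < 2) pair2 (- Fy) Fx i)) ord0 ord0 =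
    Fxx * Fy ^+ 2 - Fxy * Fx * Fy *+ 2 + Fyy * Fx ^+ 2.
  rewrite quadE !pair2_0 !pair2_max !pair2_0 FyxE; ring.
split; [exact: kE | | by rewrite matE].
(* Entry (i, j) of [hessian] differentiates by i first and then by j, so its rows are (Fxx, Fxy) and
   (Fyx, Fyy), as in the explicit matrix. *)
have -> : Tan F P *m hessian F P *m (Tan F P)^T =
    (\row_(j < 2) pair2 (- Fy) Fx j)
              *m (\matrix_(i < 2, j < 2)
                    pair2 (pair2 Fxx Fxy) (pair2 Fyx Fyy) i j)
              *m (\col_(i < 2) pair2 (- Fy) Fx i).
  congr (_ *m _ *m _).
    apply/matrixP => i j; rewrite !mxE.
    by elim/ord2_ind: i; elim/ord2_ind: j.
  by apply/matrixP => i j; rewrite !mxE.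
rewrite matE [k]kF powR_3half ?addr_ge0 ?sqr_ge0 //.
by rewrite /eucl_norm big_ord2 !mxE.
Qed.
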